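(* Let $k$ and $n$ be integers with $1\leq k\leq n-1$ and $n$ even. Then the maximum number of edges of a connected graph $G$ of order $n$ with $rd(G)=k$ is $\left\lfloor\frac{(k+1)(n-1)}{2}\right\rfloor$.
   Context: All graphs are simple, finite and undirected. For a nontrivial connected graph $G$ with an edge-coloring (adjacent edges may receive the same color), an edge-cut $R$ (a set of edges whose removal disconnects $G$) is a rainbow cut if no two edges of $R$ have the same color; it separates vertices $u,v$ if $u$ and $v$ lie in different components of $G-R$. The coloring is a rainbow disconnection coloring if for every two distinct vertices $u,v$ there is a rainbow cut separating them. The rainbow disconnection number $rd(G)$ is the smallest number of colors in a rainbow disconnection coloring of $G$. *)

(* Defs.v *)
From mathcomp Require Import all_boot.

Set Implicit Arguments.
Unset Strict Implicit.
Unset Printing Implicit Defensive.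

Record sgraph := SGraph {
  vertex :> finType;
  adj : rel vertex;
  adj_sym : symmetric adj;
  adj_irr : irreflexive adj }.

Definition edges (G : sgraph) : {set {set G}} :=
  [set [set p.1; p.2] | p : G * G & adj p.1 p.2].

Definition connected (G : sgraph) : bool :=
  [forall x : G, forall y : G, connect (@adj G) x y].

Section DeleteEdges.
Variables (G : sgraph) (R : {set {set G}}).

Definition del_adj : rel G := fun x y => adj x y && ([set x; y] \notin R).

Lemma del_adj_sym : symmetric del_adj.
Proof. by move=> x y; rewrite /del_adj adj_sym setUC. Qed.

Lemma del_adj_irr : irreflexive del_adj.
Proof. by move=> x; rewrite /del_adj adj_irr. Qed.

Definition del_edges : sgraph := SGraph del_adj_sym del_adj_irr.

End DeleteEdges.

Definition edge_cut (G : sgraph) (R : {set {set G}}) : bool :=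
  (R \subset edges G) && ~~ connected (del_edges R).

Definition separates (G : sgraph) (R : {set {set G}}) (u v : G) : bool :=
  ~~ connect (@adj (del_edges R)) u v.

(* An edge-coloring with palette 'I_m is a function on all vertex sets, of     *)
(* which only the values on edges matter: cuts contain nothing but edges.      *)
Definition rainbow_cut (G : sgraph) m (c : {ffun {set G} -> 'I_m})
    (R : {set {set G}}) : bool :=
  edge_cut R && [forall e in R, forall f in R, (c e == c f) ==> (e == f)].

Definition rainbow_disconnection_coloring (G : sgraph) m
    (c : {ffun {set G} -> 'I_m}) : bool :=
  [forall u : G, forall v : G, (u != v) ==>
    [exists R : {set {set G}}, rainbow_cut c R && separates R u v]].

Definition rd_colorable (G : sgraph) (m : nat) : bool :=
  [exists c : {ffun {set G} -> 'I_m}, rainbow_disconnection_coloring c].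

(* Give distinct colors to all edges; the edges at u then separate u from v.   *)
Lemma rd_colorable_ex (G : sgraph) : exists m, rd_colorable G m.
Proof.
exists #|{set G}|; apply/existsP; exists [ffun e => enum_rank e].
apply/forallP=> u; apply/forallP=> v; apply/implyP=> neq_uv.
set R := [set e in edges G | u \in e].
have sepR : separates R u v.
  apply/negP=> /connectP[[|w p] /= pth lst]; first by rewrite lst eqxx in neq_uv.
  case/andP: pth => /andP[uw /negP uwR] _; apply: uwR.
  rewrite !inE eqxx andbT.
  by apply/imsetP; exists (u, w); rewrite ?inE.
apply/existsP; exists R; rewrite sepR andbT; apply/andP; split; last first.
  apply/forall_inP=> e _; apply/forall_inP=> f _; rewrite !ffunE.
  by apply/implyP=> /eqP/enum_rank_inj->.
apply/andP; split; first by apply/subsetP=> e; rewrite inE => /andP[].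
by apply: contra sepR => /forallP/(_ u)/forallP/(_ v).
Qed.

Definition rd (G : sgraph) : nat := ex_minn (rd_colorable_ex G).

(* Main.v *)
(* The boundary size of vertex sets is symmetric and submodular.  Splitting    *)
(* recursively along minimum cuts, as in a Gomory-Hu tree, gives n - 1 vertex  *)
(* sets of boundary at most k such that each pair of vertices is split by at   *)
(* least one of them, and at most n - 1 pairs by exactly one.  Counting split  *)
(* edges, 2 |E| - (n - 1) <= k (n - 1).  For the converse, a hub is joined to  *)
(* all elements of Z/(n - 1), and x to y if x + y lies in a set of k - 1       *)
(* colours; since n - 1 is odd, doubling is injective, and a few more edges    *)
(* give every vertex but the hub degree k (with at most one exception of       *)
(* degree k - 1) while its edges have distinct colours.  Its star is then a    *)
(* rainbow cut.  Fewer than k colours are excluded by the upper bound.         *)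
Require Import Defs.
From mathcomp Require Import all_boot ssralg finalg zmodp zify.

Set Implicit Arguments.
Unset Strict Implicit.
Unset Printing Implicit Defensive.

Import GRing.Theory.

(** A rainbow cut has at most [m] edges, so any two vertices are split by a set of boundary at most
    [m] ([rainbow_separable]), and [cut_basis_exists] condenses these into [n - 1] sets. Every edge
    split by two of them is counted twice in the total boundary; the at most [n - 1] others are
    counted once, which yields [rd_colorable_edges]. For sharpness, any two vertices of [sum_graph]
    include one other than the hub, whose star is rainbow ([rd_colorable_stars]); its degrees are
    summed in [card_sum_graph_edges]. *)

(** * Families of small cuts of a symmetric submodular function *)

Section CutTree.
Variable U : finType.
Implicit Types (S X Y A B : {set U}) (L : seq {set U}).

Definition splits (s t : U) : pred {set U} := fun X => (s \in X) != (t \in X).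

Definition split_once S L : {set U * U} :=
  [set p | [&& p.1 \in S, p.2 \in S & count (splits p.1 p.2) L == 1]].

Lemma splitsC s t : splits s t =1 splits t s.
Proof. by move=> X; rewrite /splits eq_sym. Qed.

Definition submodular (d : {set U} -> nat) :=
  forall X Y, d (X :&: Y) + d (X :|: Y) <= d X + d Y.

(** The factor 2 is there because [split_once] collects ordered pairs. *)
Definition cut_basis (d : {set U} -> nat) k S L :=
  [/\ size L = #|S|.-1, {in L, forall X, d X <= k},
      {in S &, forall s t, s != t -> has (splits s t) L}
    & #|split_once S L| <= 2 * #|S|.-1].

Definition separable (d : {set U} -> nat) k S :=
  {in S &, forall s t, s != t -> exists X, [/\ s \in X, t \notin X & d X <= k]}.

Definition crosses S B := (S :&: B != set0) && (S :\: B != set0).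

Lemma crossesP S B :
  reflect (exists s t, [/\ s \in S, t \in S, s \in B & t \notin B]) (crosses S B).
Proof.
apply: (iffP andP) => [[/set0Pn[s] /setIP[sS sB] /set0Pn[t] /setDP[tS tB]]|].
  by exists s, t.
case=> s [t [sS tS sB tB]].
by split; apply/set0Pn; [exists s | exists t]; rewrite inE ?sS ?tS ?sB ?tB.
Qed.

(* The side [B] of a minimum terminal cut, with the complement of [B]          *)
(* contracted to [x0]; uncrossing keeps the terminals inside [B] separable.    *)
Lemma separable_contract d k S B x0 (f := fun x => if x \in B then x else x0) :
  submodular d -> (forall X, d (~: X) = d X) -> separable d k S ->
  crosses S B -> (forall X, crosses S X -> d B <= d X) -> x0 \notin B ->
  separable (fun Y => d (f @^-1: Y)) k (S :&: B).
Proof.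
move=> sub symd sep /crossesP[a [b [aS bS aB bB]]] minB x0B.
have preI X : f @^-1: (X :&: B) = X :&: B.
  apply/setP=> x; rewrite 2!inE /f !inE.
  by case: (boolP (x \in B)) => [->|_] //; rewrite (negbTE x0B) !andbF.
(* [X :|: B] still separates [a] from [c], so it costs at least [d B]; submodularity passes the
   saving to [X :&: B]. *)
have uncross X c : c \in S -> c \notin B -> c \notin X -> d X <= k ->
    d (X :&: B) <= k.
  move=> cS cB cX dX; have := sub X B.
  have : d B <= d (X :|: B).
    by apply/minB/crossesP; exists a, c; rewrite !inE aB orbT (negbTE cX).
  lia.
move=> s t /setIP[sS sB] /setIP[tS tB] st.
have [X [sX tX dX]] := sep s t sS tS st.
(* If [X] contains [b], its complement avoids [b] and is uncrossed instead. *)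
have [bX|bX] := boolP (b \in X); last first.
  exists (X :&: B); rewrite !inE sX sB (negbTE tX); split=> //.
  by rewrite preI (uncross X b).
exists (~: (~: X :&: B)); rewrite !inE sX tX tB; split=> //.
by rewrite preimsetC preI symd (uncross _ b) ?symd // inE bX.
Qed.

(** Induction on the terminals: split [S] along a cheapest crossing set [A] and recurse on both
    sides, the opposite side being contracted. Sets from one side are constant on the other, so only
    pairs across [A] are new, and at most one unordered such pair is split by [A] alone. *)
Lemma cut_basis_exists d k S :
  submodular d -> (forall X, d (~: X) = d X) -> separable d k S ->
  exists L, cut_basis d k S L.
Proof.
have small d' S' : #|S'| <= 1 -> cut_basis d' k S' [::].
  move=> S1; split=> //; first by move: S1; case: #|S'| => [|[]].
    by move=> s t sS tS; rewrite (card_le1_eqP S1 s t sS tS) eqxx.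
  rewrite (_ : split_once _ _ = set0) ?cards0 //.
  by apply/setP=> p; rewrite !inE !andbF.
(* [d] is generalized because contraction replaces it by its composite with a preimage. *)
elim: {S}#|S| {-2}S (leqnn #|S|) d => [|m IH] S leS d sub symd sep.
  by exists [::]; apply/small/(leq_trans leS).
have [S1|S2] := leqP #|S| 1; first by exists [::]; apply: small.
have [a [b [aS bS ab]]] := card_gt1P S2.
have [X0 [aX0 bX0 _]] := sep a b aS bS ab.
have P0 : crosses S X0 by apply/crossesP; exists a, b.
have side B : crosses S B -> (forall X, crosses S X -> d B <= d X) ->
    exists L, cut_basis d k (S :&: B) L /\
      {in L, forall X, {in ~: B &, forall y z, (y \in X) = (z \in X)}}.
  move=> cB minB; have /crossesP[s [x0 [sS xS sB xB]]] := cB.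
  set f := fun x => if x \in B then x else x0.
  have lt : #|S :&: B| <= m.
    rewrite -ltnS; apply: leq_trans leS; apply/proper_card/properP.
    by split; [exact: subsetIl | exists x0; rewrite ?inE ?(negbTE xB) ?andbF].
  have [|||L [szL dL sepL cntL]] := IH _ lt (fun Y => d (f @^-1: Y)).
  - by move=> X Y; rewrite preimsetI preimsetU.
  - by move=> X; rewrite preimsetC.
  - exact: separable_contract.
  have fB x : x \in B -> f x = x by rewrite /f => ->.
  have cf s1 t1 : s1 \in B -> t1 \in B ->
      splits s1 t1 \o (fun Y => f @^-1: Y) =1 splits s1 t1.
    by move=> sB1 tB1 X; rewrite /= /splits !inE !fB.
  exists [seq f @^-1: Y | Y <- L]; split; last first.
    move=> _ /mapP[Y _ ->] y z; rewrite !inE /f => /negbTE-> /negbTE->.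
    by [].
  split; first by rewrite size_map.
  - by move=> _ /mapP[Y YL ->]; apply: dL.
  - move=> s1 t1 /setIP[s1S s1B] /setIP[t1S t1B] ne.
    by rewrite has_map (eq_has (cf _ _ s1B t1B)) sepL // inE ?s1S ?t1S.
  - rewrite (_ : split_once _ _ = split_once (S :&: B) L) //.
    apply/setP=> -[s1 t1]; rewrite !inE /=.
    case: (boolP (s1 \in B)) => s1B; last by rewrite !andbF.
    case: (boolP (t1 \in B)) => t1B; last by rewrite !andbF.
    by rewrite count_map (eq_count (cf _ _ s1B t1B)).
have [A cA minA] := arg_minnP d P0.
have cCA : crosses S (~: A).
  case/crossesP: cA => s [t [sS tS sA tA]].
  by apply/crossesP; exists t, s; rewrite !inE tA sA.
have [L1 [[sz1 d1 sep1 cnt1] cst1]] := side A cA minA.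
have [X cX|L2 [[sz2 d2 sep2 cnt2] cst2]] := side (~: A) cCA.
  by rewrite symd minA.
rewrite setCK in cst2.
have same1 s t X : s \notin A -> t \notin A -> X \in L1 -> splits s t X = false.
  move=> sA tA XL; rewrite /splits (cst1 X XL s t) ?eqxx //; by rewrite inE.
have same2 s t X : s \in A -> t \in A -> X \in L2 -> splits s t X = false.
  by move=> sA tA XL; rewrite /splits (cst2 X XL s t) ?eqxx.
have cnt0 (p : pred {set U}) L : (forall X, X \in L -> p X = false) ->
    count p L = 0.
  move=> h; apply/eqP; rewrite -leqn0 leqNgt -has_count -all_predC.
  by apply/allP=> X /h /= ->.
have szS : #|S| = #|S :&: A| + #|S :&: ~: A| by rewrite -setDE cardsID.
have g1 : 0 < #|S :&: A| by case/andP: cA; rewrite card_gt0.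
have g2 : 0 < #|S :&: ~: A| by case/andP: cCA; rewrite card_gt0.
have memI s : s \in S -> s \in A -> s \in S :&: A by move=> h1 h2; rewrite inE h1.
have memD s : s \in S -> s \notin A -> s \in S :&: ~: A.
  by move=> h1 h2; rewrite !inE h1.
have dA : d A <= k.
  have [X [aX bX dX]] := sep a b aS bS ab.
  by apply: leq_trans dX; apply/minA/crossesP; exists a, b.
exists (A :: L1 ++ L2); split.
- rewrite /= size_cat sz1 sz2; lia.
- move=> X; rewrite inE mem_cat => /or3P[/eqP->|/d1|/d2] //.
- move=> s t sS tS ne; rewrite /= has_cat.
  case: (boolP (s \in A)) => sA; case: (boolP (t \in A)) => tA.
  + by rewrite sep1 ?orbT ?memI.
  + by rewrite /splits sA (negbTE tA).
  + by rewrite /splits tA (negbTE sA).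
  + by rewrite sep2 ?orbT ?memD.
set L := A :: _.
pose Q := [set p in split_once S L | (p.1 \in A) && (p.2 \notin A)].
have Q1 : #|Q| <= 1.
  have cross s t : (s, t) \in Q -> [/\ s \in S :&: A, t \in S :&: ~: A,
     {in L1, forall X, (s \in X) = (t \in X)}
   & {in L2, forall X, (s \in X) = (t \in X)}].
    rewrite !inE /= => /andP[/and3P[-> -> +] /andP[sA tA]].
    rewrite sA tA /= {1}/splits sA (negbTE tA) count_cat /= => h.
    have all0 L' : count (splits s t) L' = 0 ->
        {in L', forall X, (s \in X) = (t \in X)}.
      move=> h0 X XL; apply/eqP; apply: contraTT isT => ne.
      have : has (splits s t) L' by apply/hasP; exists X.
      by rewrite has_count h0.
    by split=> //; apply: all0; lia.
  (* If [s] and [s'] differ, some set of [L1] splits them; agreeing with [t] and [t'] respectively,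
     it would split these too, but it is constant outside [A]. Likewise for [t], [t'] and [L2]. *)
  apply/card_le1_eqP=> -[s' t'] [s t] /cross[sA' tA' e1' e2'] /cross[sA tA e1 e2].
  congr pair; apply/eqP; apply: contraTT isT => ne.
    have /hasP[X XL] := sep1 s s' sA sA' ne.
    rewrite /splits e1 // e1' //.
    case/setIP: tA => _; case/setIP: tA' => _; rewrite !inE => h1 h2.
    by have := same1 t t' X h2 h1 XL; rewrite /splits => ->.
  have /hasP[X XL] := sep2 t t' tA tA' ne.
  rewrite /splits -e2 // -e2' //.
  case/setIP: sA => _; case/setIP: sA' => _ h1 h2.
  by have := same2 s s' X h2 h1 XL; rewrite /splits => ->.
pose Q' := [set (p.2, p.1) | p in Q].
have Q'1 : #|Q'| <= 1 by apply: leq_trans (leq_imset_card _ _) Q1.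
have cov : split_once S L \subset
    split_once (S :&: A) L1 :|: split_once (S :&: ~: A) L2 :|: (Q :|: Q').
  apply/subsetP=> -[s t] h; move: (h).
  rewrite !inE /= count_cat => /and3P[-> -> /=].
  case: (boolP (s \in A)) => sA; case: (boolP (t \in A)) => tA /=.
  + rewrite {1}/splits sA tA eqxx (cnt0 _ L2) => [|X]; last exact: same2.
    by rewrite add0n addn0 => ->.
  + by move=> ->.
  + move=> e; rewrite orbC; have -> // : (s, t) \in Q'.
    apply/imsetP; exists (t, s) => //; move: h.
    rewrite !inE /= sA tA /= => /and3P[-> -> /=].
    by rewrite splitsC (eq_count (splitsC s t)) => ->.
  + rewrite {1}/splits (negbTE sA) (negbTE tA) eqxx (cnt0 _ L1) => [|X].
      by rewrite !add0n => ->.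
    exact: same1.
have -> : 2 * #|S|.-1 =
    2 * #|S :&: A|.-1 + 2 * #|S :&: ~: A|.-1 + (1 + 1) by lia.
apply: leq_trans (subset_leq_card cov) _.
apply: leq_trans (leq_card_setU _ _).1 (leq_add _ _).
  by apply: leq_trans (leq_card_setU _ _).1 (leq_add cnt1 cnt2).
by apply: leq_trans (leq_card_setU _ _).1 (leq_add Q1 Q'1).
Qed.

End CutTree.

(** * Edge boundaries and the upper bound *)

Section EdgeCuts.
Variable G : sgraph.
Implicit Types X Y : {set G}.

(** Only the orientation leaving [X] is counted, so each crossing edge contributes 1. *)
Definition boundary X : nat :=
  \sum_(p : G * G | adj p.1 p.2) ((p.1 \in X) && (p.2 \notin X)).

Lemma sum_adj_swap (F : G * G -> nat) :
  \sum_(p | adj p.1 p.2) F p = \sum_(p : G * G | adj p.1 p.2) F (p.2, p.1).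
Proof.
pose sw (p : G * G) := (p.2, p.1).
have swK : involutive sw by case.
rewrite (reindex_inj (inv_inj swK)) /=.
by apply: eq_bigl => p; rewrite /= adj_sym.
Qed.

Lemma boundaryC X : boundary (~: X) = boundary X.
Proof.
rewrite /boundary sum_adj_swap; apply: eq_bigr => p _ /=.
by rewrite !inE negbK andbC.
Qed.

Lemma boundary_submodular : submodular boundary.
Proof.
move=> X Y; rewrite /boundary -!big_split /=; apply: leq_sum => p _.
rewrite !inE.
by case: (p.1 \in X); case: (p.1 \in Y); case: (p.2 \in X); case: (p.2 \in Y).
Qed.

Lemma boundary_double X :
  2 * boundary X = \sum_(p : G * G | adj p.1 p.2) splits p.1 p.2 X.
Proof.
rewrite mul2n -addnn -{1}boundaryC -big_split /=; apply: eq_bigr => p _.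
by rewrite /splits !inE; case: (p.1 \in X); case: (p.2 \in X).
Qed.

Lemma set2_eq (T : finType) (a b c d : T) : a != b ->
  [set a; b] = [set c; d] -> (a, b) = (c, d) \/ (a, b) = (d, c).
Proof.
move=> ab e.
have : a \in [set c; d] by rewrite -e !inE eqxx.
have : b \in [set c; d] by rewrite -e !inE eqxx orbT.
move: ab; rewrite !inE => ab /pred2P[] eb /pred2P[] ea; move: ab;
  rewrite ea eb ?eqxx //; by [right | left].
Qed.

Lemma adj_neq (x y : G) : adj x y -> x != y.
Proof. by apply: contraTneq => ->; rewrite adj_irr. Qed.

Lemma mem_edges (x y : G) : adj x y -> [set x; y] \in edges G.
Proof. by move=> xy; apply/imsetP; exists (x, y); rewrite ?inE. Qed.

Lemma handshake : \sum_(p : G * G | adj p.1 p.2) 1 = 2 * #|edges G|.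
Proof.
rewrite (partition_big (fun p => [set p.1; p.2]) (mem (edges G))) /=; last first.
  by move=> p; apply: mem_edges.
rewrite mulnC -sum_nat_const; apply: eq_bigr => e /imsetP[[a b]].
rewrite inE /= => ab ->.
rewrite sum1dep_card (_ : [set _ | _] = [set (a, b); (b, a)]).
  by rewrite cards2 xpair_eqE (negbTE (adj_neq ab)).
apply/setP=> -[c d]; rewrite !inE /=; apply/idP/idP.
  case/andP=> cd /eqP e'; have [->|->] := set2_eq (adj_neq cd) e'.
    by rewrite eqxx.
  by rewrite eqxx orbT.
by case/pred2P=> -[-> ->]; rewrite ?ab ?eqxx // adj_sym ab setUC eqxx.
Qed.

(** The component of [s] after deleting a rainbow cut has its whole boundary in that cut, whose size
    is at most the number of colours. *)
Lemma rainbow_separable m : rd_colorable G m -> separable boundary m [set: G].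
Proof.
case/existsP=> c /forallP rdc s t _ _ st.
have /existsP[R /andP[/andP[/andP[subR _] rb] sep]] :=
  implyP (forallP (rdc s) t) st.
have Rm : #|R| <= m.
  rewrite -[leqRHS]card_ord -(card_in_imset (f := c) (D := mem R)) ?max_card //.
  move=> e f eR fR cef.
  have /forall_inP/(_ f fR) := forall_inP rb e eR.
  by rewrite cef eqxx => /eqP.
pose X : {set G} := [set x | connect (@adj (del_edges R)) s x].
exists X; split.
- by rewrite inE connect0.
- by rewrite inE.
apply: leq_trans Rm; rewrite /boundary.
have cutR (p : G * G) : adj p.1 p.2 && ((p.1 \in X) && (p.2 \notin X)) ->
    [set p.1; p.2] \in R.
  case/and3P=> ap; rewrite !inE => sp; apply: contraR => nR.
  by apply: connect_trans sp _; apply: connect1; apply/andP.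
rewrite (eq_bigr (fun p => if (p.1 \in X) && (p.2 \notin X) then 1 else 0));
  last by move=> p _; case: ifP.
rewrite -big_mkcondr /= sum1dep_card.
rewrite -(card_in_imset (f := fun p : G * G => [set p.1; p.2])).
  apply/subset_leq_card/subsetP=> _ /imsetP[p + ->].
  by rewrite inE => /cutR.
move=> [a b] [a' b']; rewrite !inE /= => /and3P[ab aX bX] /and3P[_ aX' bX'] e.
have [//|[ea eb]] := set2_eq (adj_neq ab) e.
by rewrite ea (negbTE bX') in aX.
Qed.

(** Double counting of pairs (oriented edge, set of [L] splitting it): each of the [2 * #|edges G|]
    orientations is split at least twice, or once if it lies in [split_once]. *)
Lemma rd_colorable_edges m : 0 < #|G| -> rd_colorable G m ->
  2 * #|edges G| <= (m + 1) * (#|G| - 1).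
Proof.
move=> G0 /rainbow_separable sep.
have [L [szL dL sepL onceL]] := cut_basis_exists boundary_submodular boundaryC sep.
rewrite cardsT in szL onceL.
have up : \sum_(X <- L) 2 * boundary X <= 2 * (m * #|G|.-1).
  rewrite -big_distrr leq_mul2l /= -szL mulnC -sum1_size big_distrl /=.
  by rewrite big_seq [leqRHS]big_seq; apply: leq_sum => X /dL; rewrite mul1n.
have lo : 2 * (2 * #|edges G|) <=
    \sum_(X <- L) 2 * boundary X + #|split_once [set: G] L|.
  under eq_bigr do rewrite boundary_double.
  rewrite exchange_big -handshake big_distrr -sum1_card /=.
  rewrite [X in _ + X]big_mkcond /= [X in _ + X](bigID (fun p => adj p.1 p.2)) /=.
  rewrite addnA; apply: leq_trans (leq_addr _ _).
  rewrite -big_split /=; apply: leq_sum => -[x y] /= xy.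
  have -> : \sum_(X <- L) splits x y X = count (splits x y) L.
    by rewrite -sum1_count [RHS]big_mkcond; apply: eq_bigr => X _; case: splits.
  have := sepL x y (in_setT _) (in_setT _) (adj_neq xy).
  rewrite has_count inE /= !inE; case: eqP => [->|] //=; lia.
move: up lo onceL; rewrite -subn1; nia.
Qed.

End EdgeCuts.

(** * Colourings by rainbow stars *)

Lemma adj_connect_sym (G : sgraph) : connect_sym (@adj G).
Proof. exact: sym_connect_sym (@adj_sym G). Qed.

(** Deleting the star of [x] isolates [x]. Asking this of one vertex in each pair lets a single hub
    go without a rainbow star. *)
Lemma rd_colorable_stars (G : sgraph) (T : finType) (K : {set T})
    (f : G -> G -> T) :
  (forall x y, f x y = f y x) ->
  (forall x y, adj x y -> f x y \in K) ->
  (forall u v : G, u != v -> exists2 x, x \in [set u; v] &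
     {in [pred y | adj x y] &, injective (f x)}) ->
  0 < #|K| -> rd_colorable G #|K|.
Proof.
move=> fC fK star K0; have [t0 t0K] := card_gt0P K0.
(* Symmetry of [f] makes the choice of orientation harmless; [t0] is a dummy colour for sets that
   are not pairs. *)
pose g (e : {set G}) :=
  if [pick p : G * G | [set p.1; p.2] == e] is Some p then f p.1 p.2 else t0.
have gE x y : x != y -> g [set x; y] = f x y.
  move=> xy; rewrite /g; case: pickP => [p /eqP e|/(_ (x, y))] /=.
    by have [[-> ->]|[-> ->]] := set2_eq xy (esym e).
  by rewrite eqxx.
apply/existsP; exists [ffun e => enum_rank_in t0K (g e)].
apply/forallP=> u; apply/forallP=> v; apply/implyP=> uv; apply/existsP.
have [x xuv injx] := star u v uv.
pose R := [set [set x; y] | y in [pred y | adj x y]].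
have isolated z : x != z -> ~~ connect (@adj (del_edges R)) x z.
  move=> xz; apply/negP=> /connectP[[|w p] /= pth lst].
    by rewrite lst eqxx in xz.
  case/andP: pth => /andP[xw /negP xwR] _; apply: xwR.
  by apply/imsetP; exists w.
have sepR : separates R u v.
  move: xuv uv; rewrite /separates !inE => /pred2P[] <-; first exact: isolated.
  rewrite eq_sym adj_connect_sym; exact: isolated.
exists R; rewrite sepR andbT; apply/andP; split.
  apply/andP; split.
    by apply/subsetP=> _ /imsetP[y xy ->]; apply: mem_edges.
  by apply: contra sepR => /forallP/(_ u)/forallP/(_ v).
apply/forall_inP=> _ /imsetP[y xy ->]; apply/forall_inP=> _ /imsetP[z xz ->].
rewrite !ffunE !gE ?adj_neq //; apply/implyP=> /eqP e.
by rewrite (injx y z) // (enum_rank_in_inj _ _ e) ?fK.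
Qed.

Lemma sum_option (T : finType) (F : option T -> nat) :
  \sum_o F o = F None + \sum_x F (Some x).
Proof.
rewrite (bigD1 None) //=; congr (_ + _).
rewrite (reindex_omap Some id) => [|[]] //=.
by apply: eq_bigl => x; rewrite eqxx.
Qed.

(** * The extremal graph *)

Section SumGraph.
Variables (Z : finZmodType) (C D : {set Z}).
Local Open Scope ring_scope.
Hypothesis double_inj : injective (fun x : Z => x + x).
Hypothesis C0 : 0 \notin C.
Hypothesis subDC : D \subset C.
Hypothesis DN : forall x, x \in D -> - x \in D.

(* [C] (of size k - 1) and [0] are the colours.  Colouring the edge xy by      *)
(* [x + y] leaves [x + x] unused at [x], so that the edge from [x] to the hub  *)
(* [None] can take this colour if it is in [C], and [0] otherwise.  In the     *)
(* first case [x] has lost a neighbour; pairing [x] with [- x] in the free     *)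
(* colour [0] makes up for it, provided that [- x] is also in this case.       *)
Definition sum_adj (u v : option Z) : bool :=
  match u, v with
  | Some x, Some y => [&& x != y & (x + y \in C) || (x + y == 0) && (x + x \in D)]
  | None, None => false
  | _, _ => true
  end.

Lemma sum_adj_sym : symmetric sum_adj.
Proof.
move=> [x|] [y|] //=; rewrite eq_sym [y + x]addrC.
congr (_ && (_ || _)); have [xy|//] := eqP; rewrite /=.
have -> : y = - x by apply/eqP; rewrite -addr_eq0 addrC xy.
by rewrite -opprD; apply/idP/idP => /DN //; rewrite opprK.
Qed.

Lemma sum_adj_irr : irreflexive sum_adj.
Proof. by case=> [x|] //=; rewrite eqxx. Qed.

Definition sum_graph : sgraph := SGraph sum_adj_sym sum_adj_irr.

Definition sum_color (u v : option Z) : Z :=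
  match u, v with
  | Some x, Some y => x + y
  | Some x, None | None, Some x => if x + x \in C then x + x else 0
  | None, None => 0
  end.

Lemma sum_graph_connected : connected sum_graph.
Proof.
have hub u : connect (@adj sum_graph) None u.
  by case: u => [x|]; rewrite ?connect0 ?connect1.
apply/forallP=> u; apply/forallP=> v; apply: connect_trans (hub v).
by rewrite adj_connect_sym.
Qed.

Lemma sum_graph_colorable : rd_colorable sum_graph #|C|.+1.
Proof.
have -> : #|C|.+1 = #|0 |: C| by rewrite cardsU1 C0.
have D0 x : x + x \notin C -> x + x \in D = false.
  by move=> h; apply: contraNF h; apply: (subsetP subDC).
have rainbow x :
    {in [pred y | sum_adj (Some x) y] &, injective (sum_color (Some x))}.
  have mixed y : sum_adj (Some x) (Some y) ->
      x + y <> if x + x \in C then x + x else 0.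
    move=> /= /andP[xy h]; case: ifPn => xC e.
      by move: xy; rewrite (addrI _ e) eqxx.
    by move: h; rewrite e (negbTE C0) D0 ?andbF.
  move=> [y|] [z|] //= hy hz; first by move/addrI->.
    by move/mixed: hy.
  by move/esym; move/mixed: hz.
apply: (@rd_colorable_stars sum_graph Z _ sum_color).
- by move=> [x|] [y|] //=; rewrite addrC.
- move=> [x|] [y|] //=; rewrite !inE;
    try by case: ifP; rewrite ?eqxx // => ->; rewrite orbT.
  by case/andP=> _ /orP[->|/andP[->]]; rewrite ?orbT.
- move=> [x|] [y|] //= _; [exists (Some x)|exists (Some x)|exists (Some y)];
    rewrite ?inE ?eqxx ?orbT //; exact: rainbow.
- by rewrite cardsU1 C0.
Qed.

(** Apart from the hub, [x] has [#|C|] neighbours, less one if [x + x] lies in [C :\: D]; as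
    doubling is a bijection, this loss occurs [#|C :\: D|] times in all. The hub edges add
    [2 * #|Z|]. *)
Lemma card_sum_graph_edges :
  (2 * #|edges sum_graph| + #|C :\: D| = (#|C| + 2) * #|Z|)%N.
Proof.
have deg x : (\sum_y sum_adj (Some x) (Some y) + ((x + x)%R \in C :\: D) = #|C|)%N.
  pose s := x + x.
  have D0 : s \in D -> s != 0.
    by move/(subsetP subDC); apply: contraTneq => ->.
  (* Neighbours are indexed by their colour [c]: colour [s] would be a loop and is lost, colour 0 is
     gained when [s] is in [D]. *)
  have ptw c : (sum_adj (Some x) (Some (- x + c)%R) +
      (if c == s then s \in C : nat else 0)
      = (if c \in C then 1 else 0) + (if c == 0%R then s \in D : nat else 0))%N.
    have e : x + (- x + c) = c by rewrite addrA subrr add0r.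
    rewrite /= -(inj_eq (addrI x)) e -/s eq_sym.
    have [->|cs] /= := eqVneq c s.
      case: (boolP (s \in D)) => sD; last by case: eqP; case: (s \in C).
      by rewrite (negbTE (D0 sD)); case: (s \in C).
    have [->|c0] := eqVneq c 0; first by rewrite (negbTE C0); case: (s \in D).
    by rewrite orbF; case: (c \in C).
  have : (\sum_y sum_adj (Some x) (Some y) + (s \in C) = #|C| + (s \in D))%N.
    rewrite (reindex_inj (addrI (- x))) /= -sum1_card [in RHS]big_mkcond /=.
    have <- : (\sum_(c : Z) (if c == s then s \in C : nat else 0) = (s \in C))%N.
      by rewrite -big_mkcond big_pred1_eq.
    have <- : (\sum_(c : Z) (if c == 0%R then s \in D : nat else 0) = (s \in D))%N.
      by rewrite -big_mkcond big_pred1_eq.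
    by rewrite -!big_split; apply: eq_bigr => c _; apply: ptw.
  rewrite inE -/s; case: (boolP (s \in D)) => [/(subsetP subDC)->|_] /=;
    last by rewrite addn0.
  by rewrite addn0 => /addIn.
have dbl : (\sum_x ((x + x)%R \in C :\: D) = #|C :\: D|)%N.
  by rewrite -sum1_card [RHS]big_mkcond [RHS](reindex_inj double_inj).
have -> : (2 * #|edges sum_graph| = \sum_u \sum_v sum_adj u v)%N.
  rewrite -handshake pair_big /= big_mkcond /=.
  by apply: eq_bigr => p _; case: sum_adj.
rewrite sum_option sum_option add0n -dbl.
under [X in (_ + X + _)%N]eq_bigr do rewrite sum_option.
rewrite /= big_split /= sum1_card -!addnA -big_split /=.
under eq_bigr do rewrite deg.
by rewrite sum_nat_const addnA addnn -mul2n [(#|Z| * _)%N]mulnC -mulnDl addnC.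
Qed.

End SumGraph.

(** Pairs of opposites are added one at a time; injectivity of doubling makes a nonzero element
    differ from its opposite. *)
Lemma symmetric_subset (Z : finZmodType) h :
  injective (fun x : Z => (x + x)%R) -> h.*2 < #|Z| ->
  exists D : {set Z}, [/\ #|D| = h.*2, (0 \notin D)%R &
    forall x, x \in D -> (- x \in D)%R].
Proof.
move=> inj2; elim: h => [|h IH] hZ.
  by exists set0; split=> [||x]; rewrite ?cards0 ?inE.
have [|D [cD D0 DN]] := IH; first by lia.
have : 0 < #|~: (0%R |: D)|.
  by move: hZ; rewrite -(cardsC (0%R |: D)) cardsU1 D0 cD; lia.
case/card_gt0P=> c; rewrite !inE negb_or => /andP[c0 cD'].
have cN : (- c != c)%R.
  apply: contraNneq c0 => e; apply/eqP/inj2.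
  by rewrite -{1}e addNr addr0.
have cND : (- c \notin D)%R by apply: contra cD' => /DN; rewrite opprK.
exists (c |: ((- c)%R |: D)); split.
- by rewrite !cardsU1 !inE negb_or eq_sym cN cD' cND cD; lia.
- by rewrite !inE !negb_or D0 andbT eq_sym c0 eq_sym oppr_eq0.
- move=> x; rewrite !inE => /or3P[/eqP->|/eqP->|/DN->];
    by rewrite ?opprK ?eqxx ?orbT.
Qed.

(** Reduction subtracts the odd modulus at most once, so equal residues of two even numbers force
    the same subtraction. *)
Lemma double_ord_inj p : ~~ odd p -> injective (fun x : 'I_p.+1 => (x + x)%R).
Proof.
move=> op x y /(congr1 val) e.
have red (z : 'I_p.+1) : (z + z) %% p.+1 = z + z - (p < z + z) * p.+1.
  have zp := ltn_ord z; case: ltnP => h; last by rewrite modn_small ?subn0.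
  by rewrite -{1}(subnK h) modnDr modn_small ?mul1n //; lia.
have {e} : (x + x) %% p.+1 = (y + y) %% p.+1 := e.
rewrite !red => e; apply/val_inj; have := ltn_ord x; have := ltn_ord y.
move: e; case: ltnP; case: ltnP => /=; lia.
Qed.

Lemma extremal_graph k n : 1 <= k <= n - 1 -> ~~ odd n ->
  exists G : sgraph, [/\ #|G| = n, connected G, rd_colorable G k
    & #|edges G| = ((k + 1) * (n - 1)) %/ 2].
Proof.
case: n => [|[|p]]; [by case: k.. |]; rewrite subn1 2!oddS negbK.
case: k => // k /andP[_ kp] op; rewrite [p.+2.-1]/= in kp *; have inj2 := double_ord_inj op.
(* Here [k] is already one less than the number of colours. [C] has this size: it is [D], plus one
   further element if [k] is odd, which accounts for the rounding down. *)
pose h := k./2; have kh := odd_double_half k.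
have [|D [cD D0 DN]] := @symmetric_subset 'I_p.+1 h inj2.
  by rewrite card_ord; lia.
have [C [cC C0 DC CD]] : exists C : {set 'I_p.+1},
    [/\ #|C| = k, (0 \notin C)%R, D \subset C & #|C :\: D| <= 1].
  case: (boolP (odd k)) => ok; last first.
    by exists D; rewrite setDv cards0; split=> //; rewrite cD -[RHS]kh (negbTE ok).
  have : 0 < #|~: (0%R |: D)|.
    have := cardsC (0%R |: D); rewrite cardsU1 D0 cD card_ord; lia.
  case/card_gt0P=> c; rewrite !inE negb_or => /andP[c0 cD'].
  exists (c |: D); split.
  - by rewrite cardsU1 cD' cD; lia.
  - by rewrite !inE negb_or eq_sym c0.
  - exact: subsetUr.
  - rewrite -[1%N](cards1 c); apply/subset_leq_card/subsetP=> x.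
    by rewrite !inE => /andP[/negbTE->]; rewrite orbF.
exists (sum_graph C DN); split.
- by rewrite card_option card_ord.
- exact: sum_graph_connected.
- by rewrite -cC; apply: sum_graph_colorable.
- have := card_sum_graph_edges inj2 C0 DC DN; rewrite cC card_ord.
  by rewrite addn1 addn2 => <-; rewrite mulnC divnMDl // divn_small ?addn0.
Qed.

Theorem theorem2p1 (k n : nat) (hk : 1 <= k <= n - 1) (hn : ~~ odd n) :
  (exists G : sgraph,
     [/\ #|G| = n, connected G, rd G = k
       & #|edges G| = ((k + 1) * (n - 1)) %/ 2])
  /\ (forall G : sgraph, #|G| = n -> connected G -> rd G = k ->
        #|edges G| <= ((k + 1) * (n - 1)) %/ 2).
Proof.
have n0 : 0 < n by lia.
split=> [|G cG _ rdG]; last first.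
  have : rd_colorable G k by rewrite -rdG /rd; case: ex_minnP.
  move/rd_colorable_edges; rewrite cG => /(_ n0); lia.
have [G [cG conG colG eG]] := extremal_graph hk hn.
exists G; split=> //; rewrite /rd; case: ex_minnP => m colm minm.
apply/eqP; rewrite eqn_leq minm //= leqNgt; apply/negP=> mk.
(* One colour fewer lowers the doubled bound by [n - 1], while rounding costs at most 1; for [n = 2]
   nothing is rounded. *)
have := rd_colorable_edges _ colm; rewrite cG eG => /(_ n0); nia.
Qed.
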